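(* Let $y\in\mathcal{Y}_F$ satisfy $\min_\xi y'_\xi\ge\frac{r^*}{2}>0$. Let $\underline{A}:=\min_\xi A_\xi(y)$, $r^{min}:=2\min_{\xi\in\mathbb{Z}}y'_\xi$ and $\bar C_i:=C_i(r^{min})$ for $i=2,3,4$. (1) Let $\Phi^{qce}_\gamma$ be the BQCE energy with blending function $\gamma$, and set $\alpha_\xi:=\frac{\gamma_\xi+\gamma_{\xi-1}}{2}$, $\beta_\xi:=1-\frac{\gamma_{\xi+1}+\gamma_{\xi-1}}{2}$. Then $$c_\gamma(y)\ge\underline{A}-2\bar C_2\|\Delta^2\alpha_\xi\|_{\ell^\infty}-2\varepsilon\bar C_3\|\Delta\beta_\xi\,y''_\xi\|_{\ell^\infty}-2\varepsilon^2\left\{\bar C_3\|(1-\beta_{\xi-1})y'''_\xi\|_{\ell^\infty}+\bar C_4\|(1-\beta_\xi)(y''_\xi)^2\|_{\ell^\infty}\right\}.$$ (2) Let $\Phi^{qnl}_\beta$ be the BQNL energy with blending function $\beta$. Then $$c_\beta(y)\ge\underline{A}-2\varepsilon\bar C_3\|\Delta\beta_\xi\,y''_\xi\|_{\ell^\infty}-2\varepsilon^2\left\{\bar C_3\|(1-\beta_{\xi-1})y'''_\xi\|_{\ell^\infty}+\bar C_4\|(1-\beta_\xi)(y''_\xi)^2\|_{\ell^\infty}\right\}.$$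
   Context: Fix $N\in\mathbb{N}$, $\varepsilon=1/N$ and $F\in(0,\infty)$. Let $\mathcal{U}$ be the space of $u:\mathbb{Z}\to\mathbb{R}$ with $u_{\xi+N}=u_\xi$ for all $\xi$ and $\sum_{\xi=1}^N u_\xi=0$, and let $\mathcal{Y}_F$ be the set of $y:\mathbb{Z}\to\mathbb{R}$ of the form $y_\xi=F\varepsilon\xi+u_\xi$ with $u\in\mathcal{U}$. Differences: $\Delta v_\xi=v_\xi-v_{\xi-1}$, $\Delta^2v_\xi=v_{\xi+1}-2v_\xi+v_{\xi-1}$, $v'_\xi=\frac{v_\xi-v_{\xi-1}}{\varepsilon}$, $v''_\xi=\frac{v_{\xi+1}-2v_\xi+v_{\xi-1}}{\varepsilon^2}$, $v'''_\xi=\frac{v_{\xi+1}-3v_\xi+3v_{\xi-1}-v_{\xi-2}}{\varepsilon^3}$. In a product such as $\Delta\beta_\xi\,y''_\xi$, $\Delta$ acts only on $\beta$. For $N$-periodic $v$, $\|v\|_{\ell^\infty}=\max_{1\le\xi\le N}|v_\xi|$ and $\|v\|_{\ell^2_\varepsilon}=(\varepsilon\sum_{\xi=1}^N|v_\xi|^2)^{1/2}$. Potential: $\phi\in C^4((0,\infty],\mathbb{R})$; there is $r^*>0$ with $\phi''(r)>0$ for $r\in(0,r^* )$ and $\phi''(r)<0$ for $r\in(r^*,\infty)$; $\phi$ and its derivatives decay at infinity. $C_i(r_0):=\sup_{r\ge r_0}|\phi^{(i)}(r)|$ for $i=1,\dots,4$. Energies (for $y\in\mathcal{Y}_F$ with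 $y'_\xi>0$ for all $\xi$). Atomistic energy: $$\Phi(y)=\varepsilon\sum_{\xi=1}^N\{\phi(y'_\xi)+\phi(y'_\xi+y'_{\xi+1})\}.$$ BQCE energy with $N$-periodic blending function $\gamma:\mathbb{Z}\to[0,1]$: $$\Phi^{qce}_\gamma(y)=\varepsilon\sum_{\xi=1}^N\Big\{\phi(y'_\xi)+\tfrac{\gamma_\xi}{2}\{\phi(2y'_\xi)+\phi(2y'_{\xi+1})\}+\tfrac{1-\gamma_\xi}{2}\{\phi(y'_{\xi-1}+y'_\xi)+\phi(y'_{\xi+1}+y'_{\xi+2})\}\Big\}.$$ BQNL energy with $N$-periodic blending function $\beta:\mathbb{Z}\to[0,1]$: $$\Phi^{qnl}_\beta(y)=\varepsilon\sum_{\xi=1}^N\Big\{\phi(y'_\xi)+\beta_\xi\phi(y'_\xi+y'_{\xi+1})+\tfrac{1-\beta_\xi}{2}\{\phi(2y'_\xi)+\phi(2y'_{\xi+1})\}\Big\}.$$ $\delta^2\Psi(y)[u,v]$ is the second variation of $\Psi$ at $y$ in directions $u,v\in\mathcal{U}$. Coercivity constants: $$c_\gamma(y)=\inf_{u\in\mathcal{U},\,\|u'\|_{\ell^2_\varepsilon}=1}\delta^2\Phi^{qce}_\gamma(y)[u,u],\qquad c_\beta(y)=\inf_{u\in\mathcal{U},\,\|u'\|_{\ell^2_\varepsilon}=1}\delta^2\Phi^{qnl}_\beta(y)[u,u].$$ Finally, $A_\xi=A_\xi(y):=\phi''(y'_\xi)+2\phi''(y'_\xi+y'_{\xi+1})+2\phi''(y'_{\xi-1}+y'_\xi)$.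 *)

(* Defs.v *)
From mathcomp Require Import all_boot all_order all_algebra.
From mathcomp Require Import all_classical all_reals all_analysis.

Set Implicit Arguments.
Unset Strict Implicit.
Unset Printing Implicit Defensive.

Import Order.TTheory GRing.Theory Num.Theory.
Import numFieldNormedType.Exports.

Local Open Scope ring_scope.
Local Open Scope classical_set_scope.

Section Lattice.
Variable R : realType.
Implicit Types (v u y : int -> R) (N : nat) (x : int).

Definition eps N : R := N%:R^-1.

Definition periodic N v : Prop := forall x, v (x + N%:Z) = v x.

Definition psum N v : R := \sum_(1 <= i < N.+1) v i%:Z.

Definition displacement N : set (int -> R) :=
  [set u | periodic N u /\ psum N u = 0].

Definition deformation N (F : R) : set (int -> R) :=
  [set y | exists2 u, displacement N u &
                      forall x, y x = F * eps N * x%:~R + u x].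

Definition blending N : set (int -> R) :=
  [set b | periodic N b /\ forall x, 0 <= b x <= 1].

Definition delta v x : R := v x - v (x - 1).
Definition delta2 v x : R := v (x + 1) - 2 * v x + v (x - 1).

Definition dq1 N v x : R := (v x - v (x - 1)) / eps N.
Definition dq2 N v x : R := (v (x + 1) - 2 * v x + v (x - 1)) / eps N ^+ 2.
Definition dq3 N v x : R :=
  (v (x + 1) - 3 * v x + 3 * v (x - 1) - v (x - 2)) / eps N ^+ 3.

(* For N > 0 and N-periodic v, this is the minimum of v over all of int. *)
Definition pmin N v : R := \big[Num.min/v 1]_(1 <= i < N.+1) v i%:Z.

Definition norm_inf N v : R := \big[Num.max/0]_(1 <= i < N.+1) `|v i%:Z|.

Definition norm_l2 N v : R :=
  Num.sqrt (eps N * psum N (fun x => `|v x| ^+ 2)).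

(* phi belongs to C^4((0,+oo]); its values on (-oo,0] are irrelevant. Decay of
   all derivatives up to order 4 gives the regularity at +oo, with
   phi(+oo) = 0. *)
Record potential (phi : R -> R) (rstar : R) : Prop := Potential {
  pot_rstar_gt0 : 0 < rstar ;
  pot_derivable : forall (i : nat) (r : R), (i < 4)%N -> 0 < r ->
    derivable (derive1n i phi) r 1 ;
  pot_continuous : forall r : R, 0 < r -> {for r, continuous (derive1n 4 phi)} ;
  pot_convex : forall r : R, 0 < r -> r < rstar -> 0 < derive1n 2 phi r ;
  pot_concave : forall r : R, rstar < r -> derive1n 2 phi r < 0 ;
  pot_decay : forall i : nat, (i <= 4)%N ->
    derive1n i phi r @[r --> +oo] --> (0 : R)
}.

(* The set is bounded for 1 <= i <= 4 when phi is a potential and 0 < r0, so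
   this real-valued supremum is the genuine one. *)
Definition Csup (phi : R -> R) (i : nat) (r0 : R) : R :=
  sup [set `|derive1n i phi r| | r in [set r | r0 <= r]].

Definition Phi_qce (phi : R -> R) N (gamma y : int -> R) : R :=
  let y' := dq1 N y in
  eps N * psum N (fun x =>
    phi (y' x)
    + gamma x / 2 * (phi (2 * y' x) + phi (2 * y' (x + 1)))
    + (1 - gamma x) / 2 *
        (phi (y' (x - 1) + y' x) + phi (y' (x + 1) + y' (x + 2)))).

Definition Phi_qnl (phi : R -> R) N (beta y : int -> R) : R :=
  let y' := dq1 N y in
  eps N * psum N (fun x =>
    phi (y' x)
    + beta x * phi (y' x + y' (x + 1))
    + (1 - beta x) / 2 * (phi (2 * y' x) + phi (2 * y' (x + 1)))).

Definition second_variation (Psi : (int -> R) -> R) (y u v : int -> R) : R :=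
  derive1 (fun s : R =>
    derive1 (fun t : R => Psi (fun x => y x + s * u x + t * v x)) 0) 0.

(* Extended-real infimum: for N = 1 there are no admissible directions and the
   constant is +oo. *)
Definition coercivity N (Psi : (int -> R) -> R) (y : int -> R) : \bar R :=
  ereal_inf [set (second_variation Psi y u u)%:E |
             u in [set u | displacement N u /\ norm_l2 N (dq1 N u) = 1]].

Definition Acoef (phi : R -> R) N y x : R :=
  let y' := dq1 N y in
  derive1n 2 phi (y' x) + 2 * derive1n 2 phi (y' x + y' (x + 1))
  + 2 * derive1n 2 phi (y' (x - 1) + y' x).

End Lattice.

(* Main.v *)
Require Import Defs.
From mathcomp Require Import all_boot all_order all_algebra.
From mathcomp Require Import all_classical all_reals all_analysis.
From mathcomp Require Import ring lra zify.

Import Order.TTheory GRing.Theory Num.Theory.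
Import numFieldNormedType.Exports.

Local Open Scope ring_scope.
Local Open Scope classical_set_scope.

(** Write [w = y'], [z = u'], and let [eps * psum] be the mean over a period.
    The second variations are quadratic forms in [z] whose only mixed terms are
    [phi'' (w x + w (x + 1)) * (z x + z (x + 1)) ^+ 2] with a nonnegative weight.
    Since [w >= rstar / 2], the second-neighbour strains are at least [rstar],
    so [phi''] is nonpositive there, and
    [(z x + z (x + 1)) ^+ 2 <= 2 * z x ^+ 2 + 2 * z (x + 1) ^+ 2] bounds the
    form from below by a diagonal one ([qnl_hess_ge]), after a summation by
    parts over the period ([psum_telescope]).

    The diagonal coefficient differs from [A] because the continuum region uses
    [phi'' (2 * w x)] in place of the two atomistic values. Taylor expansion
    around [2 * w x] gives a second-order remainder, bounded through [C4], and
    first-order terms proportional to the discrete derivative of [(1 - beta) * y''].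
    The discrete product rule turns the latter into the two [C3] terms
    ([qnl_coef_ge]). This is the QNL bound.

    For the BQCE energy, regrouping the second-neighbour terms bond by bond
    gives exactly the QNL form with the stated [beta], plus the diagonal term
    with coefficient [- 2 * delta2 alpha x * phi'' (2 * w x)] ([qce_hess_qnl]),
    which costs the [C2] term. *)

(** * Periodic lattice functions *)

Lemma periodicMz {R : realType} (N : nat) (v : int -> R) (k x : int) :
  Defs.periodic N v -> v (x + k * N%:Z) = v x.
Proof.
move=> vN; have vn n z : v (z + n%:Z * N%:Z) = v z.
  elim: n z => [|n IHn] z; first by rewrite mul0r addr0.
  by rewrite intS mulrDl mul1r addrA IHn vN.
case: (intP k) => [|n|n]; [by rewrite mul0r addr0 | exact: vn |].
by rewrite mulNr -[in RHS](subrK (n.+1%:Z * N%:Z) x) vn.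
Qed.

(** The definitions of [pmin] and [norm_inf] only see the sites 1..N; this
    representative lets them bound the values at all sites. *)
Lemma periodic_rep {R : realType} (N : nat) (v : int -> R) (x : int) :
  (0 < N)%N -> Defs.periodic N v -> exists2 i, i \in index_iota 1 N.+1 & v x = v i%:Z.
Proof.
move=> N0 vN; have NZ : (0 < N%:Z)%R by rewrite ltz_nat.
have NZ0 : N%:Z != 0 by rewrite gt_eqF.
have := modz_ge0 (x - 1) NZ0; have := ltz_pmod (x - 1) NZ.
have := divz_eq (x - 1) N%:Z.
case: ((x - 1) %% N%:Z)%Z => // m xE mN _.
exists m.+1; first by rewrite mem_index_iota ltnS /=.
rewrite -(periodicMz N v ((x - 1) %/ N%:Z)%Z m.+1 vN); congr (v _).
by rewrite intS; lia.
Qed.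

Lemma pmin_le {R : realType} (N : nat) (v : int -> R) (x : int) :
  (0 < N)%N -> Defs.periodic N v -> pmin N v <= v x.
Proof.
by move=> N0 vN; have [i iN ->] := periodic_rep N v x N0 vN; exact: ge_bigmin_seq.
Qed.

Lemma norm_inf_ge {R : realType} (N : nat) (v : int -> R) (x : int) :
  (0 < N)%N -> Defs.periodic N v -> `|v x| <= norm_inf N v.
Proof.
move=> N0 vN; have [i iN ->] := periodic_rep N v x N0 vN.
exact: (@le_bigmax_seq _ _ _ _ _ _ xpredT (fun i : nat => `|v i%:Z|)).
Qed.

Lemma ler_psum {R : realType} (N : nat) (v w : int -> R) :
  (forall x, v x <= w x) -> psum N v <= psum N w.
Proof. by move=> vw; apply: ler_sum. Qed.

Lemma psumD {R : realType} (N : nat) (v w : int -> R) :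
  psum N (fun x => v x + w x) = psum N v + psum N w.
Proof. exact: big_split. Qed.

Lemma psumZ {R : realType} (N : nat) (k : R) (v : int -> R) :
  psum N (fun x => k * v x) = k * psum N v.
Proof. by rewrite /psum -mulr_sumr. Qed.

(** Summation by parts over a period: a difference of a periodic function sums
    to zero. *)
Lemma psum_telescope {R : realType} (N : nat) (v : int -> R) :
  Defs.periodic N v -> psum N (fun x => v (x + 1) - v x) = 0.
Proof.
move=> vN; rewrite /psum.
under eq_bigr => i _ do rewrite -[i%:Z + 1]addrC -intS.
by rewrite (telescope_sumr (fun i : nat => v i%:Z))// intS vN subrr.
Qed.

(** * Second derivatives along a line *)

(** The first derivative is asked for on a neighbourhood of 0 only, because
    the strains along a line are positive, and the potential differentiable,
    only near its base point. *)
Definition has_derive2_at0 {R : realType} (g : R -> R) (d : R) : Prop :=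
  exists2 g1 : R -> R,
    (\forall s \near (0 : R), is_derive s (1 : R) g (g1 s)) &
    is_derive (0 : R) (1 : R) g1 d.

Lemma has_derive2_at0D {R : realType} (f g : R -> R) (a b : R) :
  has_derive2_at0 f a -> has_derive2_at0 g b ->
  has_derive2_at0 (fun r => f r + g r) (a + b).
Proof.
move=> [f1 f1E f1D] [g1 g1E g1D]; exists (fun r => f1 r + g1 r).
  by apply: filterS2 f1E g1E => s fs gs; exact: is_deriveD.
exact: is_deriveD.
Qed.

Lemma has_derive2_at0Z {R : realType} (k : R) (f : R -> R) (a : R) :
  has_derive2_at0 f a -> has_derive2_at0 (fun r => k * f r) (k * a).
Proof.
move=> [f1 f1E f1D]; exists (fun r => k * f1 r).
  by apply: filterS f1E => s fs; exact: is_deriveZ.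
exact: is_deriveZ.
Qed.

Lemma has_derive2_at0_psum {R : realType} (N : nat) (f : int -> R -> R) (a : int -> R) :
  (forall x, has_derive2_at0 (f x) (a x)) ->
  has_derive2_at0 (fun r => psum N (fun x => f x r)) (psum N a).
Proof.
move=> fa; rewrite /psum; elim: N => [|N IHN].
  rewrite big_geq//; under eq_fun => r do rewrite big_geq//.
  by exists (fun=> 0); [near=> s|]; exact: is_derive_cst.
rewrite big_nat_recr//=; under eq_fun => r do rewrite big_nat_recr//=.
exact: has_derive2_at0D.
Unshelve. all: by end_near.
Qed.

Lemma has_derive2_at0_affine {R : realType} (f f1 : R -> R) (a b c : R) :
  (\forall s \near a, is_derive s (1 : R) f (f1 s)) ->
  is_derive a (1 : R) f1 c ->
  has_derive2_at0 (fun r => f (a + r * b)) (c * b ^+ 2).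
Proof.
have affD s : is_derive s (1 : R) (fun r : R => a + r * b) b.
  by apply: is_derive_eq; rewrite /GRing.scale/=; ring.
move=> fE f1D; exists (fun r => f1 (a + r * b) * b).
  have affC : (fun r : R => a + r * b) r @[r --> (0 : R)] --> a.
    rewrite -[X in _ --> X]addr0 -[X in _ --> _ + X](mul0r b).
    by apply: cvgD; [exact: cvg_cst|apply: cvgM; [exact: cvg_id|exact: cvg_cst]].
  have fs : \forall s \near (0 : R),
      is_derive (a + s * b) (1 : R) f (f1 (a + s * b)) by exact: affC _ fE.
  near=> s.
  have fDs : is_derive (a + s * b) (1 : R) f (f1 (a + s * b)) by near: s.
  exact: (@is_derive1_comp _ f (fun r => a + r * b) s _ _ fDs (affD s)).
have f1D' : is_derive (a + 0 * b) (1 : R) f1 c by rewrite mul0r addr0.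
have gD := @is_derive1_comp _ f1 (fun r => a + r * b) 0 _ _ f1D' (affD 0).
have -> : (fun r => f1 (a + r * b) * b) = b \*: (f1 \o (fun r => a + r * b)).
  by apply/funext => r; rewrite /= mulrC.
by apply: is_derive_eq; rewrite /GRing.scale/=; ring.
Unshelve. all: by end_near.
Qed.

(** For equal directions the two nested derivatives both act on
    [g (s + t)]. *)
Lemma second_variationE {R : realType} (Psi : (int -> R) -> R)
    (y u : int -> R) (g : R -> R) (d : R) :
  (forall s t, Psi (fun x => y x + s * u x + t * u x) = g (s + t)) ->
  has_derive2_at0 g d -> second_variation Psi y u u = d.
Proof.
move=> PsiE [g1 g1E g1D]; rewrite /second_variation derive1E.
rewrite -(@derive_val _ _ _ _ _ _ _ g1D); apply: near_eq_derive.
near=> s; have gs : is_derive s (1 : R) g (g1 s) by near: s.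
under eq_fun => t do rewrite PsiE.
rewrite derive1E -[g1 s]mulr1.
have sD : is_derive (0 : R) (1 : R) (fun t : R => s + t) 1.
  rewrite -[X in is_derive _ _ _ X]add0r.
  exact: (is_deriveD (is_derive_cst s (0 : R) (1 : R))
                     (is_derive_id (0 : R) (1 : R))).
have gs' : is_derive (s + 0) (1 : R) g (g1 s) by rewrite addr0.
exact: (@derive_val _ _ _ _ _ _ _
  (@is_derive1_comp _ g (fun t => s + t) 0 _ _ gs' sD)).
Unshelve. all: by end_near.
Qed.

(** * The potential *)

Lemma potential_is_derive {R : realType} (phi : R -> R) rstar :
  potential phi rstar -> forall (i : nat) (r : R), (i < 4)%N -> 0 < r ->
  is_derive r (1 : R) (derive1n i phi) (derive1n i.+1 phi r).
Proof.
move=> hphi i r i4 r0; rewrite derive1nS derive1E; apply: derivableP.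
exact: (pot_derivable hphi).
Qed.

Lemma potential_continuous {R : realType} (phi : R -> R) rstar :
  potential phi rstar -> forall (i : nat) (r : R), (i <= 4)%N -> 0 < r ->
  {for r, continuous (derive1n i phi)}.
Proof.
move=> hphi i r; rewrite leq_eqVlt => /predU1P[->|i4] r0.
  exact: (pot_continuous hphi).
exact/differentiable_continuous/derivable1_diffP/(pot_derivable hphi).
Qed.

(** The derivatives are bounded on a half-line away from 0: by continuity on a
    segment, and by the decay at infinity beyond it. Boundedness is what makes
    the real-valued supremum an upper bound. *)
Lemma le_Csup {R : realType} (phi : R -> R) rstar :
  potential phi rstar -> forall (i : nat) (r0 r : R), (i <= 4)%N -> 0 < r0 ->
  r0 <= r -> `|derive1n i phi r| <= Csup phi i r0.
Proof.
move=> hphi i r0 r i4 r00 r0r; apply: ub_le_sup; last by exists r.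
have [M [Mreal MP]] : \forall s \near +oo, `|derive1n i phi s| < 1.
  by apply: (cvgr_norm_lt (0 : R) (pot_decay hphi i4)); rewrite normr0.
have cphi : {within `[r0, M + 1], continuous (derive1n i phi)}.
  apply: continuous_in_subspaceT => s; rewrite inE/= in_itv/= => /andP[r0s _].
  exact: (potential_continuous _ _ hphi _ _ i4 (lt_le_trans r00 r0s)).
have /compact_bounded[K [_ /(_ (K + 1))]] :=
  continuous_compact cphi (@segment_compact R r0 (M + 1)).
rewrite ltrDl ltr01 => /(_ isT) KP.
exists (Num.max (K + 1) 1) => _ [s /= r0s <-]; rewrite le_max.
have [sM|Ms] := leP s (M + 1); last first.
  by rewrite (ltW (MP s _)) ?orbT// (lt_trans _ Ms)// ltrDl.
by rewrite KP//; exists s => //=; rewrite in_itv/= r0s.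
Qed.

(** At [rstar] itself the sign is the limit of the one on the right. *)
Lemma potential_concave_le0 {R : realType} (phi : R -> R) rstar :
  potential phi rstar -> forall r : R, rstar <= r -> derive1n 2 phi r <= 0.
Proof.
move=> hphi r; rewrite le_eqVlt => /predU1P[<-|]; last first.
  by move=> /(pot_concave hphi)/ltW.
have r0 := pot_rstar_gt0 hphi.
rewrite leNgt; apply/negP => phi0.
have : \forall s \near rstar, 0 < derive1n 2 phi s.
  exact: (cvgr_gt _ (potential_continuous _ _ hphi 2 rstar isT r0)).
move=> /nbhs_ballP[e /= e0 /(_ (rstar + e / 2))].
have eE : `|rstar - (rstar + e / 2)| < e.
  by rewrite opprD addNKr normrN gtr0_norm; lra.
move=> /(_ eE); apply/negP; rewrite -leNgt ltW//.
by apply: (pot_concave hphi); lra.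
Qed.

(** * Taylor bound *)

(** Two applications of the mean value theorem to
    [g t - g 0 - g1 0 * t - K * t ^+ 2 / 2]. *)
Lemma taylor2_le01 {R : realType} (g g1 g2 : R -> R) (K : R) :
  (forall t : R, t \in `[0, 1]%R -> is_derive t (1 : R) g (g1 t)) ->
  (forall t : R, t \in `[0, 1]%R -> is_derive t (1 : R) g1 (g2 t)) ->
  (forall t : R, t \in `[0, 1]%R -> g2 t <= K) ->
  g 1 <= g 0 + g1 0 + K / 2.
Proof.
move=> gD g1D g2K.
pose k (t : R) := g t - g1 0 * t - K / 2 * (t * t).
pose k1 (t : R) := g1 t - g1 0 - K * t.
have kD (t : R) : t \in `[0, 1]%R -> is_derive t (1 : R) k (k1 t).
  move=> t01; have ? := gD t t01.
  by apply: is_derive_eq; rewrite /k1 /GRing.scale/=; field.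
have k1D (t : R) : t \in `[0, 1]%R -> is_derive t (1 : R) k1 (g2 t - K).
  move=> t01; have ? := g1D t t01.
  by apply: is_derive_eq; rewrite /GRing.scale/=; ring.
have oc (b t : R) : b <= 1 -> t \in `]0, b[%R -> t \in `[0, 1]%R.
  by rewrite !in_itv/= => b1 /andP[t0 tb]; apply/andP; split; lra.
have cc (b t : R) : b <= 1 -> t \in `[0, b]%R -> t \in `[0, 1]%R.
  by rewrite !in_itv/= => b1 /andP[t0 tb]; apply/andP; split; lra.
have [|t t01 kE] := @MVT_segment R k k1 0 1 ler01
  (fun t ht => kD t (oc 1 t (lexx _) ht)).
  by apply: derivable_within_continuous => t /(kD t)[].
have /[!in_itv]/=/andP[t0 t1] := t01.
have [|s s01 k1E] := @MVT_segment R k1 _ 0 t t0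
  (fun s hs => k1D s (oc t s t1 hs)).
  by apply: derivable_within_continuous => s /(cc t s t1)/(k1D s)[].
have := mulr_ge0 (_ : 0 <= K - g2 s) t0.
rewrite subr_ge0 g2K; last exact: cc t1 s01.
move: kE k1E; rewrite /k /k1; move=> kE k1E /(_ isT); nra.
Qed.

(** Restricting to the segment from [a] to [b] treats both orders of [a] and
    [b] at once. *)
Lemma taylor2_le {R : realType} (f f1 f2 : R -> R) (m a b C : R) :
  m <= a -> m <= b ->
  (forall r : R, m <= r -> is_derive r (1 : R) f (f1 r)) ->
  (forall r : R, m <= r -> is_derive r (1 : R) f1 (f2 r)) ->
  (forall r : R, m <= r -> f2 r <= C) ->
  f b <= f a + f1 a * (b - a) + C * (b - a) ^+ 2 / 2.
Proof.
move=> ma mb fD f1D f2C.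
have lD (t : R) : is_derive t (1 : R) (fun t : R => a + t * (b - a)) (b - a).
  by apply: is_derive_eq; rewrite /GRing.scale/=; ring.
have ml (t : R) : t \in `[0, 1]%R -> m <= a + t * (b - a).
  by rewrite in_itv/= => /andP[t0 t1]; nra.
have := @taylor2_le01 R (fun t : R => f (a + t * (b - a)))
  (fun t : R => (b - a) * f1 (a + t * (b - a)))
  (fun t : R => (b - a) * (f2 (a + t * (b - a)) * (b - a))) (C * (b - a) ^+ 2).
rewrite !mul0r !mul1r !addr0 subrKC mulrC [f1 a * _]mulrC; apply.
- move=> t /ml mt; rewrite mulrC.
  exact: (@is_derive1_comp _ f (fun t : R => a + t * (b - a)) t
            _ _ (fD _ mt) (lD t)).
- move=> t /ml mt; apply: is_deriveZ.
  exact: (@is_derive1_comp _ f1 (fun t : R => a + t * (b - a)) t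
            _ _ (f1D _ mt) (lD t)).
- move=> t /ml mt; have := ler_wpM2r (sqr_ge0 (b - a)) (f2C _ mt).
  by congr (_ <= _); ring.
Qed.

(** * The Hessians and their diagonal parts *)

Lemma dq1_line {R : realType} (N : nat) (y u : int -> R) (s t : R) (x : int) :
  dq1 N (fun x => y x + s * u x + t * u x) x =
  dq1 N y x + (s + t) * dq1 N u x.
Proof. by rewrite /dq1; ring. Qed.

Lemma dq1_periodic {R : realType} (N : nat) (u : int -> R) :
  Defs.periodic N u -> Defs.periodic N (dq1 N u).
Proof. by move=> uN x; rewrite /dq1 addrAC !uN. Qed.

Lemma deformation_dq1_periodic {R : realType} (N : nat) (F : R) (y : int -> R) :
  deformation N F y -> Defs.periodic N (dq1 N y).
Proof.
move=> [u [uN _] yE] x; rewrite /dq1 !yE [_ + N%:Z - 1]addrAC !uN.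
by congr (_ / _); rewrite !rmorphB !rmorphD /=; ring.
Qed.

(** The densities of the two second variations in direction [u], for arbitrary
    coefficients in place of [phi''] at the first neighbours ([a]), at the
    second neighbours ([s]) and at the Cauchy-Born strain ([c]); [z] stands for
    [u']. *)
Definition qnl_hess {R : realType} (a s c b z : int -> R) (x : int) : R :=
  a x * z x ^+ 2 + b x * (s x * (z x + z (x + 1)) ^+ 2)
  + (1 - b x) / 2 * (c x * (2 * z x) ^+ 2 + c (x + 1) * (2 * z (x + 1)) ^+ 2).

Definition qce_hess {R : realType} (a s c g z : int -> R) (x : int) : R :=
  a x * z x ^+ 2
  + g x / 2 * (c x * (2 * z x) ^+ 2 + c (x + 1) * (2 * z (x + 1)) ^+ 2)
  + (1 - g x) / 2 * (s (x - 1) * (z (x - 1) + z x) ^+ 2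
                     + s (x + 1) * (z (x + 1) + z (x + 2)) ^+ 2).

(** The coefficient of [z x ^+ 2] once the mixed terms
    [(z x + z (x + 1)) ^+ 2] are replaced by
    [2 * z x ^+ 2 + 2 * z (x + 1) ^+ 2]. *)
Definition qnl_coef {R : realType} (a s c b : int -> R) (x : int) : R :=
  a x + 2 * b x * s x + 2 * b (x - 1) * s (x - 1)
  + 2 * ((1 - b x) + (1 - b (x - 1))) * c x.

(** The replacement discards [- (b x * s x) * (z x - z (x + 1)) ^+ 2], which is
    nonnegative because [s <= 0]. *)
Lemma qnl_hess_ge {R : realType} (N : nat) (a s c b z : int -> R) :
  Defs.periodic N s -> Defs.periodic N c -> Defs.periodic N b ->
  Defs.periodic N z ->
  (forall x, s x <= 0) -> (forall x, 0 <= b x) ->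
  psum N (fun x => qnl_coef a s c b x * z x ^+ 2)
  <= psum N (qnl_hess a s c b z).
Proof.
move=> sN cN bN zN s0 b0.
pose G (x : int) : R :=
  (2 * b (x - 1) * s (x - 1) + 2 * (1 - b (x - 1)) * c x) * z x ^+ 2.
have GN : Defs.periodic N G.
  by move=> x; rewrite /G ![_ + N%:Z + _]addrAC !(sN, cN, bN, zN).
rewrite -[leLHS]addr0 -(psum_telescope N _ GN) -psumD.
apply: ler_psum => x; rewrite /qnl_hess /qnl_coef /G addrK.
have := mulr_ge0 (mulr_ge0 (b0 x) (_ : 0 <= - s x)) (sqr_ge0 (z x - z (x + 1))).
rewrite oppr_ge0 s0 => /(_ isT) h.
by rewrite -subr_ge0; move: h; congr (_ <= _); field.
Qed.

(** The energy-based blending puts the weight [(1 - g x) / 2] on the bond pairs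
    centred at [x - 1] and [x + 1]. Shifting each such term to its own pair gives
    it the weight [b x = 1 - (g (x + 1) + g (x - 1)) / 2], as in a QNL Hessian.
    The Cauchy-Born terms collect to [4 * alpha x], where the QNL Hessian has
    [2 * (alpha (x + 1) + alpha (x - 1))]; hence the term in [delta2]. *)
Lemma qce_hess_qnl {R : realType} (N : nat) (a s c g z : int -> R) :
  Defs.periodic N s -> Defs.periodic N c -> Defs.periodic N g ->
  Defs.periodic N z ->
  psum N (qce_hess a s c g z) =
  psum N (fun x =>
    qnl_hess a s c (fun x => 1 - (g (x + 1) + g (x - 1)) / 2) z x
    + -2 * delta2 (fun x => (g x + g (x - 1)) / 2) x * c x * z x ^+ 2).
Proof.
move=> sN cN gN zN.
(* the boundary terms of all the index shifts involved *)
pose W (x : int) : R :=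
  (2 * g (x - 1) - g x - g (x - 1 - 1)) * (c x * z x ^+ 2)
  + (1 - g (x - 1)) / 2 * (s x * (z x + z (x + 1)) ^+ 2)
  - (1 - g x) / 2 * (s (x - 1) * (z (x - 1) + z x) ^+ 2).
have WN : Defs.periodic N W.
  by move=> x; rewrite /W ![_ + N%:Z + _]addrAC !(sN, cN, gN, zN).
rewrite -[RHS]addr0 -(psum_telescope N _ WN) -psumD.
apply: eq_bigr => i _; move: (i%:Z) => x.
rewrite /qce_hess /qnl_hess /delta2 /W !addrK.
rewrite (_ : x + 2 = x + 1 + 1); last by lia.
by field.
Qed.

Lemma potential_derive2_line {R : realType} (phi : R -> R) rstar (a b : R) :
  potential phi rstar -> 0 < a ->
  has_derive2_at0 (fun r => phi (a + r * b)) (derive1n 2 phi a * b ^+ 2).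
Proof.
move=> hphi a0; apply: (@has_derive2_at0_affine _ _ (derive1n 1 phi)).
  near=> s; apply: (potential_is_derive _ _ hphi 0) => //.
  by near: s; exact: lt_nbhsr.
exact: (potential_is_derive _ _ hphi 1).
Unshelve. all: by end_near.
Qed.

Lemma second_variation_qnl {R : realType} (N : nat) (phi : R -> R) rstar
    (b y u : int -> R) :
  potential phi rstar -> (forall x, 0 < dq1 N y x) ->
  let w := dq1 N y in
  second_variation (Phi_qnl phi N b) y u u =
  eps R N * psum N (qnl_hess (fun x => derive1n 2 phi (w x))
    (fun x => derive1n 2 phi (w x + w (x + 1)))
    (fun x => derive1n 2 phi (2 * w x)) b (dq1 N u)).
Proof.
move=> hphi w0 w; pose z := dq1 N u.
apply: (@second_variationE _ _ _ _ (fun r => eps R N * psum N (fun x =>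
  phi (w x + r * z x) + b x * phi ((w x + w (x + 1)) + r * (z x + z (x + 1)))
  + (1 - b x) / 2 * (phi (2 * w x + r * (2 * z x))
                     + phi (2 * w (x + 1) + r * (2 * z (x + 1))))))).
  move=> s t; rewrite /Phi_qnl; congr (_ * _); apply: eq_bigr => i _.
  move: (i%:Z) => x; rewrite !dq1_line -/w -/z.
  by congr (phi _ + _ * phi _ + _ * (phi _ + phi _)); ring.
have wpos x : 0 < w x := w0 x.
apply/has_derive2_at0Z/has_derive2_at0_psum => x; rewrite /qnl_hess.
by repeat (apply: has_derive2_at0D || apply: has_derive2_at0Z);
  apply: (@potential_derive2_line _ _ rstar) => //;
  do ?[exact: wpos | apply: addr_gt0 | apply: mulr_gt0].
Qed.

Lemma second_variation_qce {R : realType} (N : nat) (phi : R -> R) rstar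
    (g y u : int -> R) :
  potential phi rstar -> (forall x, 0 < dq1 N y x) ->
  let w := dq1 N y in
  second_variation (Phi_qce phi N g) y u u =
  eps R N * psum N (qce_hess (fun x => derive1n 2 phi (w x))
    (fun x => derive1n 2 phi (w x + w (x + 1)))
    (fun x => derive1n 2 phi (2 * w x)) g (dq1 N u)).
Proof.
move=> hphi w0 w; pose z := dq1 N u.
apply: (@second_variationE _ _ _ _ (fun r => eps R N * psum N (fun x =>
  phi (w x + r * z x)
  + g x / 2 * (phi (2 * w x + r * (2 * z x))
               + phi (2 * w (x + 1) + r * (2 * z (x + 1))))
  + (1 - g x) / 2 *
    (phi ((w (x - 1) + w (x - 1 + 1)) + r * (z (x - 1) + z x))
     + phi ((w (x + 1) + w (x + 1 + 1)) + r * (z (x + 1) + z (x + 2))))))).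
  move=> s t; rewrite /Phi_qce; congr (_ * _); apply: eq_bigr => i _.
  move: (i%:Z) => x; rewrite !dq1_line -/w -/z subrK.
  rewrite (_ : x + 2 = x + 1 + 1); last by lia.
  by congr (phi _ + _ * (phi _ + phi _) + _ * (phi _ + phi _)); ring.
have wpos x : 0 < w x := w0 x.
apply/has_derive2_at0Z/has_derive2_at0_psum => x; rewrite /qce_hess.
by repeat (apply: has_derive2_at0D || apply: has_derive2_at0Z);
  apply: (@potential_derive2_line _ _ rstar) => //;
  do ?[exact: wpos | apply: addr_gt0 | apply: mulr_gt0].
Qed.

(** * The modelling error of the coefficient *)

(** Both second-neighbour coefficients are expanded around the Cauchy-Born
    strain [2 * w x]. The first-order terms combine to a discrete derivative of
    [(1 - b) * y''], and the discrete product rule splits it into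
    [delta b * y''] and [(1 - b) * y''']; only the latter carries another
    factor [e]. *)
Lemma qnl_coef_ge {R : realType} (N : nat) (phi : R -> R) rstar
    (b y : int -> R) (m : R) (x : int) :
  (0 < N)%N -> potential phi rstar -> 0 < m ->
  (forall x, m <= 2 * dq1 N y x) -> Defs.periodic N (dq1 N y) ->
  Defs.periodic N b -> (forall x, 0 <= b x <= 1) ->
  Acoef phi N y x
  - 2 * eps R N * Csup phi 3 m * norm_inf N (fun x => delta b x * dq2 N y x)
  - 2 * eps R N ^+ 2 *
      (Csup phi 3 m * norm_inf N (fun x => (1 - b (x - 1)) * dq3 N y x)
       + Csup phi 4 m * norm_inf N (fun x => (1 - b x) * dq2 N y x ^+ 2))
  <= qnl_coef (fun x => derive1n 2 phi (dq1 N y x))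
       (fun x => derive1n 2 phi (dq1 N y x + dq1 N y (x + 1)))
       (fun x => derive1n 2 phi (2 * dq1 N y x)) b x.
Proof.
move=> N0 hphi m0 mw wN bN b01.
pose w := dq1 N y; pose e := eps R N.
have {}wN : Defs.periodic N w by [].
have e0 : 0 < e by rewrite invr_gt0 ltr0n.
have eN0 : e != 0 by rewrite gt_eqF.
pose D := dq2 N y.
have wS z : w (z + 1) = w z + e * D z.
  by rewrite /w /D /dq1 /dq2 addrK -/e; field.
have DS : D x = D (x - 1) + e * dq3 N y x.
  rewrite /D /dq2 /dq3 subrK -/e (_ : x - 2 = x - 1 - 1); last by lia.
  by field.
have DN : Defs.periodic N D.
  (* [w] is periodic even though [y] is not, so [D] is read off from [w] *)
  move=> z; have := wS (z + N%:Z); rewrite addrAC !wN wS => /addrI.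
  by move/(mulfI eN0).
have D3N : Defs.periodic N (dq3 N y).
  move=> z; have E k : dq3 N y k = (D k - D (k - 1)) / e.
    rewrite /D /dq2 /dq3 subrK -/e (_ : k - 2 = k - 1 - 1); last by lia.
    by field.
  by rewrite !E addrAC !DN.
have wsum z : m <= w z + w (z + 1).
  by have := mw z; have := mw (z + 1); rewrite -/w; lra.
have pos r : m <= r -> 0 < r by exact: lt_le_trans.
have C4P r : m <= r -> derive1n 4 phi r <= Csup phi 4 m.
  move=> mr; apply: le_trans (ler_norm _) _.
  exact: (le_Csup _ _ hphi).
have tay r s : m <= r -> m <= s -> derive1n 2 phi s <= derive1n 2 phi r
    + derive1n 3 phi r * (s - r) + Csup phi 4 m * (s - r) ^+ 2 / 2.
  move=> mr ms; apply: (@taylor2_le R (derive1n 2 phi) (derive1n 3 phi) (derive1n 4 phi) m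
    r s (Csup phi 4 m) mr ms _ _ C4P) => q /pos q0;
    exact: (potential_is_derive _ _ hphi).
have T1 := tay _ _ (mw x) (wsum x).
have T2 := tay _ _ (mw x) (wsum (x - 1)).
have := wS x; have := wS (x - 1); rewrite !subrK => wS1 wS2.
rewrite -/w subrK in T1 T2.
have C3P : `|derive1n 3 phi (2 * w x)| <= Csup phi 3 m.
  exact: (le_Csup _ _ hphi).
have n1P : `|delta b x * D x| <= norm_inf N (fun x => delta b x * D x).
  apply: (norm_inf_ge N (fun x => delta b x * D x)) => // z.
  by rewrite /delta [_ + N%:Z - 1]addrAC !(bN, DN).
have n2P : `|(1 - b (x - 1)) * dq3 N y x|
    <= norm_inf N (fun x => (1 - b (x - 1)) * dq3 N y x).
  apply: (norm_inf_ge N (fun x => (1 - b (x - 1)) * dq3 N y x)) => // z.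
  by rewrite [_ + N%:Z - 1]addrAC !(bN, D3N).
have n3P z : `|(1 - b z) * D z ^+ 2|
    <= norm_inf N (fun x => (1 - b x) * D x ^+ 2).
  apply: (norm_inf_ge N (fun x => (1 - b x) * D x ^+ 2)) => // k.
  by rewrite !(bN, DN).
have n3x := le_trans (ler_norm _) (n3P x).
have n3x1 := le_trans (ler_norm _) (n3P (x - 1)).
rewrite -/e -/D -/w.
move: n1P n2P {n3P} n3x n3x1.
set n1 := norm_inf _ _; set n2 := norm_inf _ _; set n3 := norm_inf _ _.
move=> n1P n2P n3x n3x1.
have C40 : 0 <= Csup phi 4 m.
  by apply: le_trans (le_Csup _ _ hphi 4%N m m isT m0 (lexx m)).
have C30 : 0 <= Csup phi 3 m by apply: le_trans C3P.
rewrite /qnl_coef /Acoef -/w subrK.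
have /andP[b0 b1] := b01 x; have /andP[b0' b1'] := b01 (x - 1).
move: T1 T2 C3P C40 C30; rewrite wS2.
have -> : w (x - 1) = w x - e * D (x - 1) by rewrite wS1; ring.
set f0 := derive1n 2 phi (w x); set p := derive1n 2 phi (w x + _).
set q := derive1n 2 phi (w x - _ + _); set c := derive1n 2 phi (2 * w x).
set f3 := derive1n 3 phi _; set C3 := Csup phi 3 m; set C4 := Csup phi 4 m.
move=> T1 T2 C3P C40 C30.
have {}T1 : p - c <= f3 * (e * D x) + C4 * (e * D x) ^+ 2 / 2.
  by rewrite lerBlDl addrA; congr (_ <= _ + _ * _ + _ * _ ^+ 2 / _): T1; ring.
have {}T2 : q - c <= - f3 * (e * D (x - 1)) + C4 * (e * D (x - 1)) ^+ 2 / 2.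
  rewrite lerBlDl addrA; move: T2; congr (_ <= _); ring.
have {}T1 := ler_wpM2l (_ : 0 <= 1 - b x) T1.
have {}T2 := ler_wpM2l (_ : 0 <= 1 - b (x - 1)) T2.
move: T1 T2; rewrite !subr_ge0 => /(_ b1) T1 /(_ b1') T2.
have C3M v n : `|v| <= n -> f3 * v <= C3 * n.
  move=> vn; apply: le_trans (ler_norm _) _; rewrite normrM.
  exact: ler_pM (normr_ge0 _) (normr_ge0 _) C3P vn.
have P1 : f3 * - (delta b x * D x) <= C3 * n1 by apply: C3M; rewrite normrN.
have P2 := C3M _ _ n2P.
have P3 := ler_wpM2l C40 n3x.
have P4 := ler_wpM2l C40 n3x1.
have {}P1 := ler_wpM2l (ltW e0) P1.
have e20 : 0 <= e ^+ 2 := sqr_ge0 e.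
have {}P2 := ler_wpM2l e20 P2.
have {}P3 := ler_wpM2l e20 P3.
have {}P4 := ler_wpM2l e20 P4.
(* the discrete product rule *)
have prod_rule : (1 - b x) * D x - (1 - b (x - 1)) * D (x - 1) =
    - (delta b x * D x) + e * ((1 - b (x - 1)) * dq3 N y x).
  by rewrite /delta DS; ring.
have {}prod_rule := congr1 (fun r => f3 * e * r) prod_rule.
rewrite /= in prod_rule.
lra.
Qed.

(** * Coercivity *)

(** Normalised directions satisfy [eps * psum (u' ^+ 2) = 1], so a bound of the
    Hessian by [L] times that quantity is a bound of the infimum by [L]. *)
Lemma coercivity_ge {R : realType} (N : nat) (Psi : (int -> R) -> R)
    (y : int -> R) (L : R) :
  (forall u, displacement N u ->
     eps R N * psum N (fun x => L * dq1 N u x ^+ 2)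
     <= second_variation Psi y u u) ->
  (L%:E <= coercivity N Psi y)%E.
Proof.
move=> LP; apply: le_ereal_inf_tmp => _ [u [uN u1] <-]; rewrite lee_fin.
apply: le_trans (LP u uN); rewrite psumZ mulrCA.
have -> : eps R N * psum N (fun x => dq1 N u x ^+ 2) = 1; last by rewrite mulr1.
move: u1; rewrite /norm_l2.
have -> : psum N (fun x => `|dq1 N u x| ^+ 2) = psum N (fun x => dq1 N u x ^+ 2).
  by apply: eq_bigr => i _; rewrite real_normK ?num_real.
set X := eps R N * _ => X1; rewrite -(expr1n _ 2) -X1 sqr_sqrtr// leNgt.
apply/negP => X0; move: X1; rewrite ler0_sqrtr ?(ltW X0)// => /eqP.
by rewrite eq_sym oner_eq0.
Qed.

Theorem theorem4p1 (R : realType) (N : nat) (hN : (0 < N)%N)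
    (F : R) (hF : 0 < F) (phi : R -> R) (rstar : R)
    (hphi : potential phi rstar)
    (y : int -> R) (hy : deformation N F y)
    (hmin : rstar / 2 <= pmin N (dq1 N y)) :
  let e := eps R N in
  let Amin := pmin N (Acoef phi N y) in
  let rmin := 2 * pmin N (dq1 N y) in
  let C2 := Csup phi 2 rmin in
  let C3 := Csup phi 3 rmin in
  let C4 := Csup phi 4 rmin in
  let y'' := dq2 N y in
  let y''' := dq3 N y in
  (forall gamma : int -> R,
    let alpha (x : int) : R := (gamma x + gamma (x - 1)) / 2 in
    let beta (x : int) : R := 1 - (gamma (x + 1) + gamma (x - 1)) / 2 in
    blending N gamma ->
    (((Amin - 2 * C2 * norm_inf N (fun x : int => delta2 alpha x)
      - 2 * e * C3 * norm_inf N (fun x : int => delta beta x * y'' x)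
      - 2 * e ^+ 2 *
          (C3 * norm_inf N (fun x : int => (1 - beta (x - 1)) * y''' x)
           + C4 * norm_inf N (fun x : int => (1 - beta x) * y'' x ^+ 2)))%R)%:E
     <= coercivity N (Phi_qce phi N gamma) y)%E) /\
  (forall beta : int -> R, blending N beta ->
    (((Amin - 2 * e * C3 * norm_inf N (fun x : int => delta beta x * y'' x)
      - 2 * e ^+ 2 *
          (C3 * norm_inf N (fun x : int => (1 - beta (x - 1)) * y''' x)
           + C4 * norm_inf N (fun x : int => (1 - beta x) * y'' x ^+ 2)))%R)%:E
     <= coercivity N (Phi_qnl phi N beta) y)%E).
Proof.
move=> e Amin rmin C2 C3 C4 y'' y'''.
set w := dq1 N y in hmin.
have wN : Defs.periodic N w := deformation_dq1_periodic _ _ _ hy.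
have wmin x : rmin <= 2 * w x by rewrite ler_pM2l// pmin_le.
have rs0 := pot_rstar_gt0 hphi.
have rsmin : rstar <= rmin by rewrite /rmin -/w; lra.
have rmin0 : 0 < rmin by lra.
have w0 x : 0 < w x by have := wmin x; lra.
pose a (x : int) : R := derive1n 2 phi (w x).
pose s (x : int) : R := derive1n 2 phi (w x + w (x + 1)).
pose c (x : int) : R := derive1n 2 phi (2 * w x).
have sN : Defs.periodic N s by move=> x; rewrite /s [_ + N%:Z + 1]addrAC !wN.
have cN : Defs.periodic N c by move=> x; rewrite /c wN.
have s0 x : s x <= 0.
  apply: (potential_concave_le0 _ _ hphi).
  by have := wmin x; have := wmin (x + 1); lra.
have AN : Defs.periodic N (Acoef phi N y).
  by move=> x; rewrite /Acoef -/w ![_ + N%:Z + _]addrAC !wN.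
have coefP b : Defs.periodic N b -> (forall x, 0 <= b x <= 1) -> forall x,
    Amin - 2 * e * C3 * norm_inf N (fun x => delta b x * y'' x)
      - 2 * e ^+ 2 *
          (C3 * norm_inf N (fun x => (1 - b (x - 1)) * y''' x)
           + C4 * norm_inf N (fun x => (1 - b x) * y'' x ^+ 2))
    <= qnl_coef a s c b x.
  move=> bN b01 x.
  apply: le_trans (qnl_coef_ge N phi rstar b y rmin x hN hphi rmin0 wmin wN bN b01).
  by rewrite !lerD2r pmin_le.
have hessP b z : Defs.periodic N b -> (forall x, 0 <= b x <= 1) ->
    Defs.periodic N z ->
    psum N (fun x => qnl_coef a s c b x * z x ^+ 2) <= psum N (qnl_hess a s c b z).
  by move=> bN b01 zN; apply: qnl_hess_ge => // x; case/andP: (b01 x).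
have e0 : 0 <= e by rewrite invr_ge0 ler0n.
split=> [g alpha beta [gN g01]|b [bN b01]]; apply: coercivity_ge => u [uN _].
- have zN := dq1_periodic N u uN.
  have betaN : Defs.periodic N beta.
    by move=> x; rewrite /beta ![_ + N%:Z + _]addrAC !gN.
  have beta01 x : 0 <= beta x <= 1.
    have /andP[? ?] := g01 (x + 1); have /andP[? ?] := g01 (x - 1).
    by rewrite /beta; apply/andP; split; lra.
  have alphaN : Defs.periodic N (delta2 alpha).
    by move=> x; rewrite /delta2 /alpha ![_ + N%:Z + _]addrAC !gN.
  have -> : second_variation (Phi_qce phi N g) y u u =
      e * psum N (qce_hess a s c g (dq1 N u)).
    exact: second_variation_qce hphi w0.
  rewrite ler_wpM2l// (qce_hess_qnl N a s c g (dq1 N u) sN cN gN zN) psumD.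
  apply: le_trans (lerD (hessP beta (dq1 N u) betaN beta01 zN) (lexx _)).
  rewrite -psumD; apply: ler_psum => x; rewrite -/(alpha) -mulrDl.
  apply: ler_wpM2r; first exact: sqr_ge0.
  have := coefP beta betaN beta01 x.
  have C2P : `|c x| <= C2 by exact: (le_Csup _ _ hphi).
  have nP := norm_inf_ge N (delta2 alpha) x hN alphaN.
  have : delta2 alpha x * c x <= C2 * norm_inf N (fun x => delta2 alpha x).
    apply: le_trans (ler_norm _) _; rewrite normrM mulrC.
    exact: ler_pM (normr_ge0 _) (normr_ge0 _) C2P nP.
  lra.
- have -> : second_variation (Phi_qnl phi N b) y u u =
      e * psum N (qnl_hess a s c b (dq1 N u)).
    exact: second_variation_qnl hphi w0.
  rewrite ler_wpM2l//.
  apply: le_trans (hessP b (dq1 N u) bN b01 (dq1_periodic N u uN)).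
  by apply: ler_psum => x; apply: ler_wpM2r; [exact: sqr_ge0|exact: coefP].
Qed.
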